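(* Let $G(x,y)\in k[[x,y]]$ be a one-dimensional formal group law of finite height over a field $k$ of characteristic $p>0$, where $k$ is large enough that every endomorphism of $G$ defined over an algebraic closure of $k$ already has coefficients in $k$. Let $u\in\mathrm{Aut}(G)$ be a nontorsion automorphism of $G$, i.e. $u^{\circ n}(x)\neq x$ for every integer $n\ge 1$. If $\psi(x)\in xk[[x]]$ satisfies $u\circ\psi=\psi\circ u$, then $\psi\in\mathrm{End}(G)$.
   Context: The height $h$ of $G$ is defined by $v_x([p]_G(x))=p^h$, where $[p]_G$ is the multiplication-by-$p$ endomorphism and $v_x$ is the $x$-adic valuation on $k[[x]]$. $\mathrm{End}(G)$ is the set of power series $f\in xk[[x]]$ with $f(G(x,y))=G(f(x),f(y))$; $\mathrm{Aut}(G)$ is the group (under composition) of invertible elements of $\mathrm{End}(G)$. $f^{\circ n}$ denotes the $n$-fold composition iterate. *)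

(* Defs.v *)
From HB Require Import structures.
From mathcomp Require Import all_boot all_order all_algebra.
From mathcomp Require Import mpoly.
Set Implicit Arguments.
Unset Strict Implicit.
Unset Printing Implicit Defensive.
Import GRing.Theory.
Local Open Scope ring_scope.

(* R[[x_1, ..., x_n]]: a series is its coefficient function on monomials, and
   equality of series is coefficientwise equality =1. *)
Definition mser (n : nat) (R : Type) : Type := 'X_{1..n} -> R.

Section Series.
Variable R : comNzRingType.

Definition ser0 n : mser n R := fun=> 0.
Definition ser1 n : mser n R := fun m => (m == 0%MM)%:R.
Definition serX n (i : 'I_n) : mser n R := fun m => (m == U_(i)%MM)%:R.

Definition ser_mul n (f g : mser n R) : mser n R := fun m =>
  \sum_(k : 'X_{1..n < (mdeg m).+1, (mdeg m).+1} | m == (k.1 + k.2)%MM)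
    f k.1 * g k.2.

Definition ser_exp n (f : mser n R) (e : nat) : mser n R :=
  iter e (ser_mul f) (@ser1 n).

Definition ser_mon n r (g : n.-tuple (mser r R)) (d : 'X_{1..n}) : mser r R :=
  \big[@ser_mul r/@ser1 r]_(i < n) ser_exp (tnth g i) (d i).

(* f(g_1, ..., g_n), meaningful only when every g_i has zero constant term:
   then g^d has no term of degree < |d|, so truncating the sum over d at
   |d| <= |m| does not change the coefficient at m. *)
Definition ser_subst n r (f : mser n R) (g : n.-tuple (mser r R)) : mser r R :=
  fun m => \sum_(d : 'X_{1..n < (mdeg m).+1}) f d * ser_mon g d m.

Definition ser_comp r (f : mser 1 R) (g : mser r R) : mser r R :=
  ser_subst f [tuple g].

Definition ser_subst2 r (G : mser 2 R) (f g : mser r R) : mser r R :=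
  ser_subst G [tuple f; g].

Definition varx : mser 1 R := serX ord0.

(* f \in x R[[x]] *)
Definition no_const (f : mser 1 R) : Prop := f 0%MM = 0.

Definition ser_iter (f : mser 1 R) (n : nat) : mser 1 R :=
  iter n (ser_comp f) varx.

(* v_x(f) = d *)
Definition xval_is (f : mser 1 R) (d : nat) : Prop :=
  (forall m, (mdeg m < d)%N -> f m = 0) /\ (exists2 m, mdeg m = d & f m != 0).

Record formal_group_law (G : mser 2 R) : Prop := FormalGroupLaw {
  fgl_0r : ser_subst2 G varx (@ser0 1) =1 varx;
  fgl_0l : ser_subst2 G (@ser0 1) varx =1 varx;
  fgl_assoc :
    let x : mser 3 R := serX (inord 0) in
    let y : mser 3 R := serX (inord 1) in
    let z : mser 3 R := serX (inord 2) in
    ser_subst2 G (ser_subst2 G x y) z =1 ser_subst2 G x (ser_subst2 G y z);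
  fgl_comm :
    let x : mser 2 R := serX (inord 0) in
    let y : mser 2 R := serX (inord 1) in
    ser_subst2 G x y =1 ser_subst2 G y x
}.

Definition fgl_mul (G : mser 2 R) (n : nat) : mser 1 R :=
  iter n (ser_subst2 G varx) (@ser0 1).

Definition has_height (p : nat) (G : mser 2 R) (h : nat) : Prop :=
  xval_is (fgl_mul G p) (p ^ h)%N.

Definition finite_height (p : nat) (G : mser 2 R) : Prop :=
  exists h, has_height p G h.

Definition fgl_End (G : mser 2 R) (f : mser 1 R) : Prop :=
  let x : mser 2 R := serX (inord 0) in
  let y : mser 2 R := serX (inord 1) in
  no_const f /\
  ser_comp f (ser_subst2 G x y) =1 ser_subst2 G (ser_comp f x) (ser_comp f y).

Definition fgl_Aut (G : mser 2 R) (u : mser 1 R) : Prop :=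
  fgl_End G u /\
  exists2 v, fgl_End G v & ser_comp u v =1 varx /\ ser_comp v u =1 varx.

Definition nontorsion (u : mser 1 R) : Prop :=
  forall n : nat, (1 <= n)%N -> ~ (ser_iter u n =1 varx).

End Series.

Arguments varx {R}.

Definition ser_map (R S : Type) n (phi : R -> S) (f : mser n R) : mser n S :=
  fun m => phi (f m).

Definition algebraic_closure (k K : fieldType) (iota : {rmorphism k -> K}) :
    Prop :=
  GRing.closed_field_axiom K /\ (forall z : K, algebraicOver iota z).

Definition all_End_over_base (k K : fieldType) (iota : {rmorphism k -> K})
    (G : mser 2 k) : Prop :=
  forall f : mser 1 K, fgl_End (ser_map iota G) f ->
    exists f0 : mser 1 k, f =1 ser_map iota f0.

(* Main.v *)
(* Write [+] for the formal group law. Finite height forces u'(0) to be a root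
   of unity, so some iterate v of u has v'(0) = 1. An endomorphism without linear
   term lies in k[[x^p]], so v = x + z with z in k[[x^p]], and
   v^p = x + z o (1 + v + ... + v^(p-1)), where the last factor again has no
   linear term. Iterating, for every c there are N >= 1 and z in k[[x^(p^c)]],
   nonzero since u is nontorsion, with u^N = x + z.
   Put Phi(x,y) = psi(x + y) - psi(x). Since psi commutes with u^N,
   Phi(x, z(x)) = z(psi(x)), which lies in k[[x^(p^c)]]. As c grows, this forces
   the coefficients a_b(x) of Phi = sum_b a_b(x) y^b to be constant one after
   another, so that Phi(x,y) = Phi(0,y) = psi(y). *)
Require Import Defs.
From HB Require Import structures.
From Stdlib Require Import FunctionalExtensionality Classical_Pred_Type.
From mathcomp Require Import all_boot all_order all_algebra.
From mathcomp Require Import mpoly.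
From mathcomp Require Import zify.
Set Implicit Arguments.
Unset Strict Implicit.
Unset Printing Implicit Defensive.
Import GRing.Theory.
Local Open Scope ring_scope.

(** * Transfer of power series identities from polynomials *)

Section Approximation.
Variable R : comNzRingType.

(** Series are bare coefficient functions, so ring and substitution identities are checked on
    polynomials agreeing with them through degree [D], for every [D]. *)
Definition approx n D (f : mser n R) (P : {mpoly R[n]}) : Prop :=
  forall m, (mdeg m <= D)%N -> f m = P@_m.

Definition trunc n D (f : mser n R) : {mpoly R[n]} :=
  \sum_(m : 'X_{1..n < D.+1}) f m *: 'X_[m].

Definition order_ge n D (f : mser n R) : Prop :=
  forall m, (mdeg m < D)%N -> f m = 0.

Lemma trunc_approx n D (f : mser n R) : approx D f (trunc D f).
Proof. by move=> m lem; rewrite mcoeff_mpoly. Qed.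

Lemma approx_ser_ext n (f g : mser n R) :
  (forall D, exists2 P, approx D f P & approx D g P) -> f = g.
Proof.
move=> H; apply: functional_extensionality => m.
by have [P Hf Hg] := H (mdeg m); rewrite Hf ?Hg.
Qed.

Lemma approx_mul n D (f g : mser n R) P Q :
  approx D f P -> approx D g Q -> approx D (ser_mul f g) (P * Q).
Proof.
move=> Hf Hg m lem; rewrite mcoeffM; apply: eq_bigr => k _.
rewrite Hf ?Hg //.
  by apply: leq_trans lem; rewrite -ltnS bmdeg.
by apply: leq_trans lem; rewrite -ltnS bmdeg.
Qed.

Lemma approx1 n D : approx D (@ser1 R n) 1.
Proof. by move=> m _; rewrite mcoeff1. Qed.

Lemma approxX n D i : approx D (@serX R n i) 'X_i.
Proof. by move=> m _; rewrite mcoeffX eq_sym. Qed.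

Lemma approx_exp n D (f : mser n R) P e :
  approx D f P -> approx D (ser_exp f e) (P ^+ e).
Proof.
move=> Hf; elim: e => [|e IH]; first exact: approx1.
by rewrite exprS /ser_exp iterS; apply: approx_mul.
Qed.

Lemma approx_mon n r D (g : n.-tuple (mser r R)) (q : n.-tuple {mpoly R[r]}) d :
  (forall i, approx D (tnth g i) (tnth q i)) ->
  approx D (ser_mon g d) (\prod_(i < n) tnth q i ^+ d i).
Proof.
move=> H; rewrite /ser_mon; apply: (big_ind2 (@approx r D)).
- exact: approx1.
- by move=> *; apply: approx_mul.
- by move=> i _; apply: approx_exp.
Qed.

Lemma ser_mul_eq0 n (f g : mser n R) m :
  (forall m1 m2, m = (m1 + m2)%MM -> f m1 * g m2 = 0) -> ser_mul f g m = 0.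
Proof. by move=> H; apply: big1 => k /eqP /H. Qed.

Lemma order_ge_mul n a b (f g : mser n R) :
  order_ge a f -> order_ge b g -> order_ge (a + b) (ser_mul f g).
Proof.
move=> Hf Hg m lm; apply: ser_mul_eq0 => m1 m2 mE.
move: lm; rewrite mE mdegD => lm.
have [la|la] := ltnP (mdeg m1) a; first by rewrite Hf ?mul0r.
by rewrite Hg ?mulr0 //; lia.
Qed.

Lemma order_ge1 n : order_ge 0 (@ser1 R n).
Proof. by []. Qed.

Lemma order_ge_exp n a (f : mser n R) e :
  order_ge a f -> order_ge (e * a) (ser_exp f e).
Proof.
move=> Hf; elim: e => [|e IH]; first exact: order_ge1.
by rewrite mulSn /ser_exp iterS; apply: order_ge_mul.
Qed.

Lemma order_ge_const n (f : mser n R) : f 0%MM = 0 -> order_ge 1 f.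
Proof. by move=> f0 m; rewrite ltnS leqn0 mdeg_eq0 => /eqP ->. Qed.

(** This is why the truncated sum in [ser_subst] computes the full substitution. *)
Lemma order_ge_mon n r (g : n.-tuple (mser r R)) d :
  (forall i, tnth g i 0%MM = 0) -> order_ge (mdeg d) (ser_mon g d).
Proof.
move=> H; rewrite /ser_mon mdegE.
apply: (big_ind2 (fun f k => order_ge k f)).
- exact: order_ge1.
- by move=> *; apply: order_ge_mul.
- by move=> i _; have := @order_ge_exp _ _ _ (d i) (order_ge_const (H i)); rewrite muln1.
Qed.

Lemma approx_subst n r D (f : mser n R) P (g : n.-tuple (mser r R)) q :
  (forall i, tnth g i 0%MM = 0) ->
  approx D f P -> (forall i, approx D (tnth g i) (tnth q i)) ->
  approx D (ser_subst f g) (P \mPo q).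
Proof.
move=> g0 Hf Hg m lem.
(* [T] matches the finite sum of [ser_subst] term by term; [P - T] only has monomials of degree
   above [mdeg m], whose images have no coefficient at [m]. *)
pose T := trunc (mdeg m) (fun d => P@_d).
have -> : P = T + (P - T) by rewrite addrC subrK.
rewrite comp_mpolyD mcoeffD [X in _ = _ + X](_ : _ = 0) ?addr0.
  rewrite /ser_subst /T /trunc (raddf_sum (comp_mpoly q)) (raddf_sum (mcoeff m)) /=.
  apply: eq_bigr => d _.
  rewrite comp_mpolyZ mcoeffZ comp_mpolyX (Hf d).
    by rewrite (approx_mon d Hg lem).
  by apply: leq_trans lem; rewrite -ltnS bmdeg.
rewrite comp_mpolyE raddf_sum big1 //= => d _; rewrite mcoeffZ.
have [ld|ld] := leqP (mdeg d) (mdeg m).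
  by rewrite mcoeffB -(trunc_approx _ ld) subrr mul0r.
by rewrite -(approx_mon d Hg lem) (order_ge_mon g0) ?mulr0.
Qed.

Lemma comp_mpolyA n r s (P : {mpoly R[n]}) (q : n.-tuple {mpoly R[r]})
    (t : r.-tuple {mpoly R[s]}) :
  (P \mPo q) \mPo t = P \mPo [tuple tnth q i \mPo t | i < n].
Proof.
rewrite [P]mpolyE !(raddf_sum (comp_mpoly q)) (raddf_sum (comp_mpoly t)).
rewrite raddf_sum; apply: eq_bigr => m _ /=; rewrite !comp_mpolyZ !comp_mpolyX rmorph_prod /=; congr (_ *: _).
by apply: eq_bigr => i _; rewrite rmorphXn /= tnth_mktuple.
Qed.

Lemma ser_subst_const n r (f : mser n R) (g : n.-tuple (mser r R)) :
  (forall i, tnth g i 0%MM = 0) -> ser_subst f g 0%MM = f 0%MM.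
Proof.
move=> g0; have l0 : (mdeg (0%MM : 'X_{1..r}) <= 0)%N by rewrite mdeg0.
(* In degree 0 each inner series is approximated by 0, and [f] by its constant term. *)
have H i : approx 0 (tnth g i) (tnth [tuple 0 | _ < n] i).
  move=> m; rewrite leqn0 mdeg_eq0 => /eqP ->.
  by rewrite tnth_mktuple mcoeff0.
have Hf : approx 0 f (f 0%MM)%:MP.
  by move=> m; rewrite leqn0 mdeg_eq0 => /eqP ->; rewrite mcoeffC eqxx mulr1.
by rewrite (approx_subst g0 Hf H l0) comp_mpolyC mcoeffC eqxx mulr1.
Qed.

(** Both sides are approximated through degree [D] by the same composite of truncations, since
    polynomial composition is associative. *)
Lemma ser_substA n r s (f : mser n R) (g : n.-tuple (mser r R))
    (h : r.-tuple (mser s R)) :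
  (forall i, tnth g i 0%MM = 0) -> (forall i, tnth h i 0%MM = 0) ->
  ser_subst (ser_subst f g) h =
  ser_subst f [tuple ser_subst (tnth g i) h | i < n].
Proof.
move=> g0 h0; apply: approx_ser_ext => D.
pose T := trunc D f; pose q := [tuple trunc D (tnth g i) | i < n].
pose t := [tuple trunc D (tnth h i) | i < r].
have Hf := @trunc_approx _ D f.
have Hg i : approx D (tnth g i) (tnth q i).
  by rewrite tnth_mktuple; apply: trunc_approx.
have Hh i : approx D (tnth h i) (tnth t i).
  by rewrite tnth_mktuple; apply: trunc_approx.
exists ((T \mPo q) \mPo t); first by do !apply: approx_subst.
rewrite comp_mpolyA; apply: approx_subst => // i; rewrite !tnth_mktuple.
  by rewrite ser_subst_const.
by apply: approx_subst => //; apply: trunc_approx.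
Qed.

Lemma ser_subst_id n (f : mser n R) :
  ser_subst f [tuple serX R i | i < n] = f.
Proof.
apply: approx_ser_ext => D; exists (trunc D f); last exact: trunc_approx.
rewrite -[X in approx _ _ X]comp_mpoly_id; apply: approx_subst => [i||i].
- by rewrite tnth_mktuple /serX eq_sym mnm1_eq0.
- exact: trunc_approx.
- by rewrite !tnth_mktuple; apply: approxX.
Qed.

Lemma ser_subst_serX n r (g : n.-tuple (mser r R)) i :
  (forall j, tnth g j 0%MM = 0) -> ser_subst (serX R i) g = tnth g i.
Proof.
move=> g0; apply: approx_ser_ext => D; exists (trunc D (tnth g i)).
  pose q := [tuple trunc D (tnth g i) | i < n].
  have -> : trunc D (tnth g i) = 'X_i \mPo q.
    by rewrite comp_mpolyXU -tnth_nth tnth_mktuple.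
  apply: approx_subst => [//||j]; first exact: approxX.
  by rewrite tnth_mktuple; apply: trunc_approx.
exact: trunc_approx.
Qed.

(** Continuity of substitution: the truncations of [g] approximate [h] as well. *)
Lemma ser_subst_congr n r D (f : mser n R) (g h : n.-tuple (mser r R)) :
  (forall i, tnth g i 0%MM = 0) -> (forall i, tnth h i 0%MM = 0) ->
  (forall i m, (mdeg m <= D)%N -> tnth g i m = tnth h i m) ->
  forall m, (mdeg m <= D)%N -> ser_subst f g m = ser_subst f h m.
Proof.
move=> g0 h0 gh m lem; pose q := [tuple trunc D (tnth g i) | i < n].
have Hg i : approx D (tnth g i) (tnth q i).
  by rewrite tnth_mktuple; apply: trunc_approx.
have Hh i : approx D (tnth h i) (tnth q i).
  by move=> d ld; rewrite -gh // Hg.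
rewrite (approx_subst g0 (trunc_approx f) Hg lem).
by rewrite (approx_subst h0 (trunc_approx f) Hh lem).
Qed.

End Approximation.

(** * Substitution into series in one and two variables *)

Section Substitution.
Variable R : comNzRingType.

Lemma mktuple1 T (F : 'I_1 -> T) : [tuple F i | i < 1] = [tuple F ord0].
Proof. by apply: eq_from_tnth => i; rewrite (ord1 i) tnth_mktuple. Qed.

Lemma mktuple2 T (F : 'I_2 -> T) :
  [tuple F i | i < 2] = [tuple F ord0; F ord_max].
Proof.
apply: eq_from_tnth => -[[|[|//]] lti]; rewrite tnth_mktuple /tnth /=.
  by congr F; apply: val_inj.
by congr F; apply: val_inj.
Qed.

Lemma tnth1_const r (f : mser r R) :
  f 0%MM = 0 -> forall i, tnth [tuple f] i 0%MM = 0.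
Proof. by move=> f0 i; rewrite (ord1 i). Qed.

Lemma tnth2_const r (f g : mser r R) :
  f 0%MM = 0 -> g 0%MM = 0 -> forall i, tnth [tuple f; g] i 0%MM = 0.
Proof. by move=> f0 g0 [[|[|//]] lti]. Qed.

Lemma serX_const n i : serX R i (0%MM : 'X_{1..n}) = 0.
Proof. by rewrite /serX eq_sym mnm1_eq0. Qed.

Lemma ser_comp_const r f (g : mser r R) :
  g 0%MM = 0 -> ser_comp f g 0%MM = f 0%MM.
Proof. by move=> g0; apply/ser_subst_const/tnth1_const. Qed.

Lemma ser_subst2_const r G (f g : mser r R) :
  f 0%MM = 0 -> g 0%MM = 0 -> ser_subst2 G f g 0%MM = G 0%MM.
Proof. by move=> f0 g0; apply/ser_subst_const/tnth2_const. Qed.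

Lemma ser_compA r f g (h : mser r R) : g 0%MM = 0 -> h 0%MM = 0 ->
  ser_comp (ser_comp f g) h = ser_comp f (ser_comp g h).
Proof.
move=> g0 h0; rewrite /ser_comp ser_substA ?mktuple1 //; exact: tnth1_const.
Qed.

Lemma ser_comp_subst2 r f g (a b : mser r R) :
  g 0%MM = 0 -> a 0%MM = 0 -> b 0%MM = 0 ->
  ser_subst2 (ser_comp f g) a b = ser_comp f (ser_subst2 g a b).
Proof.
move=> g0 a0 b0; rewrite /ser_subst2 /ser_comp ser_substA ?mktuple1 //.
  exact: tnth1_const.
exact: tnth2_const.
Qed.

Lemma ser_subst2_comp r G f g (h : mser r R) :
  f 0%MM = 0 -> g 0%MM = 0 -> h 0%MM = 0 ->
  ser_comp (ser_subst2 G f g) h = ser_subst2 G (ser_comp f h) (ser_comp g h).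
Proof.
move=> f0 g0 h0; rewrite /ser_subst2 /ser_comp ser_substA ?mktuple2 //.
  exact: tnth2_const.
exact: tnth1_const.
Qed.

Lemma ser_subst2_subst2 r G f g (a b : mser r R) :
  f 0%MM = 0 -> g 0%MM = 0 -> a 0%MM = 0 -> b 0%MM = 0 ->
  ser_subst2 (ser_subst2 G f g) a b =
  ser_subst2 G (ser_subst2 f a b) (ser_subst2 g a b).
Proof.
move=> f0 g0 a0 b0; rewrite /ser_subst2 ser_substA ?mktuple2 //.
  exact: tnth2_const.
exact: tnth2_const.
Qed.

Lemma ser_comp_varx r (f : mser r R) : f 0%MM = 0 -> ser_comp varx f = f.
Proof. by move=> f0; rewrite /ser_comp ser_subst_serX //; apply: tnth1_const. Qed.

Lemma ser_comp_id (f : mser 1 R) : ser_comp f varx = f.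
Proof. by rewrite -[RHS]ser_subst_id mktuple1. Qed.

Lemma ser_subst2_id (G : mser 2 R) :
  ser_subst2 G (serX R (inord 0)) (serX R (inord 1)) = G.
Proof.
rewrite -[RHS]ser_subst_id mktuple2 /ser_subst2; congr (ser_subst _ [tuple serX R _; serX R _]).
  by apply: val_inj; rewrite /= inordK.
by apply: val_inj; rewrite /= inordK.
Qed.

Lemma ser_subst2_serX0 r (f g : mser r R) : f 0%MM = 0 -> g 0%MM = 0 ->
  ser_subst2 (serX R (inord 0)) f g = f.
Proof.
move=> f0 g0; rewrite /ser_subst2 ser_subst_serX; last exact: tnth2_const.
by rewrite (tnth_nth f) /= inordK.
Qed.

Lemma ser_subst2_serX1 r (f g : mser r R) : f 0%MM = 0 -> g 0%MM = 0 ->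
  ser_subst2 (serX R (inord 1)) f g = g.
Proof.
move=> f0 g0; rewrite /ser_subst2 ser_subst_serX; last exact: tnth2_const.
by rewrite (tnth_nth f) /= inordK.
Qed.

Lemma ser_comp0 r (f : mser r R) : ser_comp (@ser0 R 1) f = @ser0 R r.
Proof.
by apply: functional_extensionality => m; apply: big1 => d _; rewrite mul0r.
Qed.

Lemma ser_comp_ser0 r (f : mser 1 R) :
  f 0%MM = 0 -> ser_comp f (@ser0 R r) = @ser0 R r.
Proof.
move=> f0; apply: functional_extensionality => m; apply: big1 => d _.
have [d0|d1] := posnP (mdeg d).
  by move/eqP: d0; rewrite mdeg_eq0 => /eqP ->; rewrite f0 mul0r.
rewrite (_ : ser_mon _ _ m = 0) ?mulr0 // /ser_mon big_ord_recl.
apply: ser_mul_eq0 => m1 m2 _; rewrite (_ : ser_exp _ _ m1 = 0) ?mul0r //.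
move: d1; rewrite mdegE big_ord1 /tnth /=; case: (d ord0) => // k _.
by apply: ser_mul_eq0 => *; rewrite mul0r.
Qed.

Lemma ser_subst_lin n r (f : mser n R) (g : n.-tuple (mser r R)) m :
  (forall i, tnth g i 0%MM = 0) -> mdeg m = 1%N ->
  ser_subst f g m = \sum_(i < n) f U_(i)%MM * tnth g i m.
Proof.
move=> g0 m1; have lem : (mdeg m <= 1)%N by rewrite m1.
pose q := [tuple trunc 1 (tnth g i) | i < n].
have Hg i : approx 1 (tnth g i) (tnth q i).
  by rewrite tnth_mktuple; apply: trunc_approx.
(* Only the affine part of [f] can reach degree 1. *)
have Hf : approx 1 f ((f 0%MM)%:MP + \sum_(i < n) f U_(i)%MM *: 'X_i).
  move=> d; rewrite leq_eqVlt ltnS leqn0 mcoeffD (raddf_sum (mcoeff d)) mcoeffC => /orP[].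
    move/mdeg1P => [i /eqP ->]; rewrite mnm1_eq0 mulr0 add0r (bigD1 i) //=.
    rewrite [X in X + _]mcoeffZ mcoeffXU eqxx mulr1 big1 ?addr0 // => j ji.
    by rewrite mcoeffZ mcoeffXU (negbTE ji) mulr0.
  rewrite mdeg_eq0 => /eqP ->; rewrite eqxx mulr1 big1 ?addr0 // => i _.
  by rewrite /= mcoeffZ mcoeffX mnm1_eq0 mulr0.
rewrite (approx_subst g0 Hf Hg lem) comp_mpolyD mcoeffD comp_mpolyC mcoeffC.
rewrite /= -mdeg_eq0 m1 mulr0 add0r (raddf_sum (comp_mpoly q)) (raddf_sum (mcoeff m)).
apply: eq_bigr => i _ /=.
by rewrite comp_mpolyZ mcoeffZ comp_mpolyXU -tnth_nth Hg.
Qed.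

Lemma ser_comp_lin r f (g : mser r R) m : g 0%MM = 0 -> mdeg m = 1%N ->
  ser_comp f g m = f U_(ord0)%MM * g m.
Proof.
move=> g0 m1; rewrite /ser_comp ser_subst_lin ?big_ord1 //; exact: tnth1_const.
Qed.

Lemma ser_subst2_lin r G (f g : mser r R) m :
  f 0%MM = 0 -> g 0%MM = 0 -> mdeg m = 1%N ->
  ser_subst2 G f g m = G U_(ord0)%MM * f m + G U_(ord_max)%MM * g m.
Proof.
move=> f0 g0 m1; rewrite /ser_subst2 ser_subst_lin //; last exact: tnth2_const.
by rewrite big_ord_recl big_ord1; congr (_ + G U_(_)%MM * _); apply: val_inj.
Qed.

Lemma ser_comp_congr r D f (g h : mser r R) :
  g 0%MM = 0 -> h 0%MM = 0 ->
  (forall m, (mdeg m <= D)%N -> g m = h m) ->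
  forall m, (mdeg m <= D)%N -> ser_comp f g m = ser_comp f h m.
Proof.
move=> g0 h0 gh; apply: ser_subst_congr => [||i]; try exact: tnth1_const.
by rewrite (ord1 i); apply: gh.
Qed.

Lemma ser_subst2_congr r D G (f g h : mser r R) :
  f 0%MM = 0 -> g 0%MM = 0 -> h 0%MM = 0 ->
  (forall m, (mdeg m <= D)%N -> g m = h m) ->
  forall m, (mdeg m <= D)%N -> ser_subst2 G f g m = ser_subst2 G f h m.
Proof.
move=> f0 g0 h0 gh; apply: ser_subst_congr => [||i]; try exact: tnth2_const.
by case: i => -[|[|//]] lti; [move=> m | apply: gh].
Qed.

(** * Powers of series and their lowest-degree forms *)

Lemma ser_mulr1 n (f : mser n R) : ser_mul f (@ser1 R n) = f.
Proof.
apply: approx_ser_ext => D; exists (trunc D f * 1).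
  by apply: approx_mul (@approx1 _ _ _); apply: trunc_approx.
by rewrite mulr1; apply: trunc_approx.
Qed.

Lemma ser_expM n (f : mser n R) a b :
  ser_exp f (a * b) = ser_exp (ser_exp f a) b.
Proof.
apply: approx_ser_ext => D; exists (trunc D f ^+ (a * b)).
  by apply/approx_exp/trunc_approx.
by rewrite exprM; do 2!apply: approx_exp; apply: trunc_approx.
Qed.

Lemma ser_mon1 r (g : mser r R) d : ser_mon [tuple g] d = ser_exp g (d ord0).
Proof. by rewrite /ser_mon big_ord_recl big_ord0 ser_mulr1. Qed.

Lemma ser_mon2 r (f g : mser r R) d :
  ser_mon [tuple f; g] d =
  ser_mul (ser_exp f (d ord0)) (ser_exp g (d ord_max)).
Proof.
rewrite /ser_mon !big_ord_recl big_ord0 ser_mulr1.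
by congr (ser_mul _ (ser_exp _ (d _))); apply: val_inj.
Qed.

Lemma ser_exp_serX n i e (m : 'X_{1..n}) :
  ser_exp (serX R i) e m = ((U_(i) *+ e)%MM == m)%:R.
Proof.
rewrite (approx_exp e (@approxX R n (mdeg m) i)) //.
by rewrite mcoeffXn.
Qed.

(** In degree [a + b], a product of terms can only be nonzero if its factors have degrees exactly
    [a] and [b]. *)
Lemma lead_mul n a b (f f' g g' : mser n R) :
  order_ge a f -> order_ge a f' -> order_ge b g -> order_ge b g' ->
  (forall m, mdeg m = a -> f m = f' m) ->
  (forall m, mdeg m = b -> g m = g' m) ->
  forall m, mdeg m = (a + b)%N -> ser_mul f g m = ser_mul f' g' m.
Proof.
move=> f0 f'0 g0 g'0 ff gg m mab; apply: eq_bigr => -[k l] /= /eqP /(congr1 (@mdeg n)).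
rewrite mdegD => e.
move: (bmnm k) (bmnm l) e => {}k {}l e.
have [lt|gt|eqa] := ltngtP (mdeg k) a; first by rewrite f0 ?f'0 ?mul0r.
  by rewrite g0 ?g'0 ?mulr0 //; lia.
by rewrite ff // gg //; lia.
Qed.

Lemma lead_exp n a (f f' : mser n R) e :
  order_ge a f -> order_ge a f' -> (forall m, mdeg m = a -> f m = f' m) ->
  forall m, mdeg m = (e * a)%N -> ser_exp f e m = ser_exp f' e m.
Proof.
move=> f0 f'0 ff; elim: e => [//|e IH].
by rewrite mulSn; apply: lead_mul => //; apply: order_ge_exp.
Qed.

End Substitution.

(** * Abelian group of series under the formal group law, and multiplication by integers *)

Section FormalGroupLaw.
Variables (R : comNzRingType) (G : mser 2 R).
Hypothesis hG : formal_group_law G.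

Local Notation add := (ser_subst2 G).

Lemma varx_const : varx 0%MM = 0 :> R.
Proof. exact: serX_const. Qed.

Lemma fgl_const : G 0%MM = 0.
Proof.
have := fgl_0r hG 0%MM; rewrite ser_subst2_const //; last exact: varx_const.
by move=> ->; apply: varx_const.
Qed.

Lemma add_const r (f g : mser r R) :
  f 0%MM = 0 -> g 0%MM = 0 -> add f g 0%MM = 0.
Proof. by move=> f0 g0; rewrite ser_subst2_const // fgl_const. Qed.

Lemma addf0 r (f : mser r R) : f 0%MM = 0 -> add f (@ser0 R r) = f.
Proof.
move=> f0; have /functional_extensionality e := fgl_0r hG.
have := congr1 (fun g => ser_comp g f) e.
by rewrite /= ser_subst2_comp ?varx_const // ser_comp0 ser_comp_varx.
Qed.

Lemma add0f r (f : mser r R) : f 0%MM = 0 -> add (@ser0 R r) f = f.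
Proof.
move=> f0; have /functional_extensionality e := fgl_0l hG.
have := congr1 (fun g => ser_comp g f) e.
by rewrite /= ser_subst2_comp ?varx_const // ser_comp0 ser_comp_varx.
Qed.

Lemma fgl_addC r (f g : mser r R) :
  f 0%MM = 0 -> g 0%MM = 0 -> add f g = add g f.
Proof.
move=> f0 g0; have /functional_extensionality e := fgl_comm hG.
have := congr1 (fun h => ser_subst2 h f g) e.
rewrite /= !ser_subst2_subst2 ?serX_const //.
by rewrite ser_subst2_serX0 // ser_subst2_serX1.
Qed.

Lemma fgl_addA r (f g h : mser r R) :
  f 0%MM = 0 -> g 0%MM = 0 -> h 0%MM = 0 ->
  add (add f g) h = add f (add g h).
Proof.
move=> f0 g0 h0; have /functional_extensionality e := fgl_assoc hG.
have t0 i : tnth [tuple f; g; h] i 0%MM = 0 by case: i => -[|[|[|//]]].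
have := congr1 (fun k => ser_subst k [tuple f; g; h]) e.
have sub2 (H : mser 2 R) a b : a 0%MM = 0 -> b 0%MM = 0 ->
    ser_subst (ser_subst2 H a b) [tuple f; g; h] =
    ser_subst2 H (ser_subst a [tuple f; g; h]) (ser_subst b [tuple f; g; h]).
  by move=> a0 b0; rewrite /ser_subst2 ser_substA ?mktuple2 //; exact: tnth2_const.
rewrite /= !sub2 ?add_const ?serX_const //.
by rewrite !ser_subst_serX // !(tnth_nth f) /= !inordK.
Qed.

Lemma fgl_addACA r (a b c d : mser r R) :
  a 0%MM = 0 -> b 0%MM = 0 -> c 0%MM = 0 -> d 0%MM = 0 ->
  add (add a b) (add c d) = add (add a c) (add b d).
Proof.
move=> a0 b0 c0 d0; rewrite !fgl_addA ?add_const //.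
by rewrite -(fgl_addA b0 c0 d0) (fgl_addC b0 c0) fgl_addA.
Qed.

Lemma fgl_coef10 : G U_(ord0)%MM = 1.
Proof.
have := fgl_0r hG U_(ord0)%MM; rewrite ser_subst2_lin ?mdeg1 ?varx_const //.
by rewrite mulr0 addr0 /varx /serX eqxx mulr1.
Qed.

Lemma fgl_coef01 : G U_(ord_max)%MM = 1.
Proof.
have := fgl_0l hG U_(ord0)%MM; rewrite ser_subst2_lin ?mdeg1 ?varx_const //.
by rewrite mulr0 add0r /varx /serX eqxx mulr1.
Qed.

Lemma add_lin r (f g : mser r R) m :
  f 0%MM = 0 -> g 0%MM = 0 -> mdeg m = 1%N -> add f g m = f m + g m.
Proof.
by move=> f0 g0 m1; rewrite ser_subst2_lin // fgl_coef10 fgl_coef01 !mul1r.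
Qed.

Lemma fgl_mul_const n : fgl_mul G n 0%MM = 0.
Proof. by elim: n => [//|n IH]; rewrite /= add_const ?varx_const. Qed.

Lemma fgl_mulS n : fgl_mul G n.+1 = add varx (fgl_mul G n).
Proof. by []. Qed.

Lemma fgl_mulD m n : fgl_mul G (m + n) = add (fgl_mul G m) (fgl_mul G n).
Proof.
elim: m => [|m IH]; first by rewrite add0f ?fgl_mul_const.
by rewrite addSn !fgl_mulS IH fgl_addA ?fgl_mul_const ?varx_const.
Qed.

Lemma fgl_mulM m n :
  fgl_mul G (m * n) = ser_comp (fgl_mul G m) (fgl_mul G n).
Proof.
elim: m => [|m IH]; first by rewrite ser_comp0.
rewrite mulSn fgl_mulD IH fgl_mulS.
by rewrite ser_subst2_comp ?fgl_mul_const ?varx_const // ser_comp_varx ?fgl_mul_const.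
Qed.

Lemma fgl_mul_lin n : fgl_mul G n U_(ord0)%MM = n%:R.
Proof.
elim: n => [//|n IH]; rewrite fgl_mulS add_lin ?fgl_mul_const ?mdeg1 ?varx_const //.
by rewrite IH /varx /serX eqxx -natr1 addrC.
Qed.

(** * The formal inverse in characteristic p *)

Section Inverse.
Variable p : nat.
Hypothesis hp : p \in [pchar R].

(** The linear coefficient of [[p]] is p = 0, so composing with [[p]] at least doubles the order. *)
Lemma fgl_mul_pX_order n : order_ge n.+1 (fgl_mul G (p ^ n)).
Proof.
elim: n => [|n IH]; first exact/order_ge_const/fgl_mul_const.
rewrite expnS fgl_mulM => m lem; apply: big1 => d _; rewrite ser_mon1.
have mdegE1 : mdeg d = d ord0 by rewrite mdegE big_ord1.
have [d0|d2|/eqP d1] := ltngtP (mdeg d) 1.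
- have /eqP -> : (d : 'X_{1..1}) == 0%MM by rewrite -mdeg_eq0; lia.
  by rewrite fgl_mul_const mul0r.
- rewrite (@order_ge_exp _ _ _ _ (d ord0) IH) ?mulr0 //; nia.
- have /mdeg1P[i /eqP ->] := d1.
  by rewrite (ord1 i) fgl_mul_lin (pcharf0 hp) mul0r.
Qed.

(* Limit of the multiplications by p^n - 1: the coefficient of degree m is
   stationary from n = m on. *)
Definition fgl_inv : mser 1 R := fun m => fgl_mul G (p ^ mdeg m - 1) m.

(** Passing from [p ^ c - 1] to [p ^ c.+1 - 1] adds [[(p - 1) * p ^ c]], which vanishes through
    degree [c]. *)
Lemma fgl_inv_congr n m : (mdeg m <= n)%N ->
  fgl_inv m = fgl_mul G (p ^ n - 1) m.
Proof.
have p0 : (0 < p)%N by apply/prime_gt0/(pcharf_prime hp).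
move=> lem; rewrite /fgl_inv -(subnK lem).
elim: (n - mdeg m)%N => [//|j ->]; set c := (j + mdeg m)%N.
have -> : (p ^ (j.+1 + mdeg m) - 1 = (p ^ c - 1) + (p - 1) * p ^ c)%N.
  have : (0 < p ^ c)%N by rewrite expn_gt0 p0.
  rewrite addSn expnS -/c; nia.
(* With a zero summand made explicit, only the second summands remain to be compared. *)
rewrite fgl_mulD -[in LHS](addf0 (fgl_mul_const (p ^ c - 1))).
apply: (@ser_subst2_congr _ _ c); rewrite ?fgl_mul_const //; last exact: leq_addl.
move=> d ld; apply/esym.
rewrite fgl_mulM.
rewrite -(@ser_comp_ser0 _ 1 (fgl_mul G (p - 1))) ?fgl_mul_const //.
apply: (@ser_comp_congr _ _ c); rewrite ?fgl_mul_const //.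
by move=> e le; apply: fgl_mul_pX_order; rewrite ltnS.
Qed.

(** Through degree n the sum agrees with [[p ^ n]], which has order above n. *)
Lemma add_varx_inv : add varx fgl_inv = @ser0 R 1.
Proof.
have p0 : (0 < p)%N by apply/prime_gt0/(pcharf_prime hp).
apply: functional_extensionality => m.
rewrite (@ser_subst2_congr _ _ (mdeg m) _ _ _ (fgl_mul G (p ^ mdeg m - 1)));
  rewrite ?varx_const ?fgl_mul_const //.
- rewrite -fgl_mulS -addn1 subnK ?expn_gt0 ?p0 //.
  by rewrite (fgl_mul_pX_order (n := mdeg m)).
- by rewrite /fgl_inv fgl_mul_const.
- exact: fgl_inv_congr.
Qed.

End Inverse.
End FormalGroupLaw.

(** * Series in powers of the variables, and Frobenius *)

Section ExponentsDivisible.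
Variable R : comNzRingType.

(* f \in R[[x_1^a, ..., x_n^a]] *)
Definition exp_dvd n a (f : mser n R) : Prop :=
  forall (m : 'X_{1..n}) i, ~~ (a %| m i)%N -> f m = 0.

Lemma exp_dvd1 n a : exp_dvd a (@ser1 R n).
Proof.
move=> m i ai; rewrite /ser1; case: eqP => // m0.
by rewrite m0 mnm0E dvdn0 in ai.
Qed.

Lemma exp_dvd_mul n a (f g : mser n R) :
  exp_dvd a f -> exp_dvd a g -> exp_dvd a (ser_mul f g).
Proof.
move=> Hf Hg m i ai; apply: ser_mul_eq0 => m1 m2 mE.
move: ai; rewrite mE mnmDE => ai.
have [a1|a1] := boolP (a %| m1 i)%N; last by rewrite (Hf _ i) ?mul0r.
by rewrite (Hg _ i) ?mulr0 // -(dvdn_addr _ a1).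
Qed.

Lemma exp_dvd_exp n a (f : mser n R) e :
  exp_dvd a f -> exp_dvd a (ser_exp f e).
Proof.
by move=> Hf; elim: e => [|e IH]; [exact: exp_dvd1 | exact: exp_dvd_mul].
Qed.

Lemma exp_dvd_trivial n (f : mser n R) : exp_dvd 1 f.
Proof. by move=> m i; rewrite dvd1n. Qed.

Section Frobenius.
Variable p : nat.
Hypothesis hp : p \in [pchar R].

Lemma mpoly_pchar n : p \in [pchar {mpoly R[n]}].
Proof.
rewrite inE /= (pcharf_prime hp) /=.
by rewrite -(mpolyC_nat n R) (pcharf0 hp) mpolyC0.
Qed.

(** The p-th power map is additive on polynomials of characteristic p, so it multiplies every
    exponent of a truncation of [f] by p. *)
Lemma exp_dvd_frobenius n a (f : mser n R) :
  exp_dvd a f -> exp_dvd (a * p) (ser_exp f p).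
Proof.
move=> Hf m i ai.
rewrite (approx_exp p (@trunc_approx R n (mdeg m) f)) //.
rewrite -(pFrobenius_autE (mpoly_pchar n)) /trunc rmorph_sum /=.
rewrite (raddf_sum (mcoeff m)) big1 //= => d _.
rewrite pFrobenius_autE exprZn mcoeffZ mcoeffXn.
case: eqP => [dE|_]; last by rewrite mulr0.
have p0 : (0 < p)%N by apply/prime_gt0/(pcharf_prime hp).
rewrite (Hf d i); first by rewrite expr0n eqn0Ngt p0 mul0r.
move: (bmnm d) dE => d' dE.
by move: ai; rewrite -dE mulmnE dvdn_pmul2r.
Qed.

Lemma exp_dvd_frobeniusX n a c (f : mser n R) :
  exp_dvd a f -> exp_dvd (a * p ^ c) (ser_exp f (p ^ c)).
Proof.
move=> Hf; elim: c => [|c IH].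
  by rewrite muln1; apply: exp_dvd_exp.
by rewrite expnSr mulnA ser_expM; apply: exp_dvd_frobenius.
Qed.

(** Only powers [s^(j p^c)] occur in [z o s], and each is the [p ^ c]-th power of [s^j]. *)
Lemma exp_dvd_comp r a c (z : mser 1 R) (s : mser r R) :
  exp_dvd (p ^ c) z -> exp_dvd a s -> exp_dvd (a * p ^ c) (ser_comp z s).
Proof.
move=> Hz Hs m i ai; apply: big1 => d _; rewrite ser_mon1.
have [/dvdnP[j ->]|qd] := boolP (p ^ c %| d ord0)%N; last first.
  by rewrite (Hz _ ord0) ?mul0r.
by rewrite ser_expM (exp_dvd_frobeniusX (exp_dvd_exp j Hs) ai) mulr0.
Qed.

End Frobenius.
End ExponentsDivisible.

Lemma mnmX1E j : (U_(ord0) *+ j : 'X_{1..1})%MM ord0 = j.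
Proof. by rewrite mulmnE mnm1E eqxx mul1n. Qed.

Lemma mnm1E1 (m : 'X_{1..1}) : m = (U_(ord0) *+ m ord0)%MM.
Proof. by apply/mnmP => i; rewrite (ord1 i) mnmX1E. Qed.

Lemma mnm1_mdeg (m : 'X_{1..1}) : mdeg m = m ord0.
Proof. by rewrite mdegE big_ord1. Qed.

(** * A criterion for a two-variable series to be independent of x *)

Section Rigidity.
Variable k : fieldType.

Lemma ser_mul_varxX (h : mser 1 k) a m :
  ser_mul (ser_exp varx a) h m =
  if (a <= m ord0)%N then h (U_(ord0) *+ (m ord0 - a))%MM else 0.
Proof.
case: ifP => [am|/negbT am]; last first.
  have X1 : order_ge a (ser_exp (@varx k) a).
    by have := order_ge_exp (e := a) (order_ge_const (varx_const k)); rewrite muln1.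
  by rewrite (order_ge_mul (b := 0) X1) // addn0 mnm1_mdeg ltnNge.
rewrite (approx_mul (approx_exp a (@approxX k _ (mdeg m) ord0))
          (@trunc_approx _ _ (mdeg m) h)) // mpolyXn mulrC.
rewrite {1}(_ : m = U_(ord0) *+ a + U_(ord0) *+ (m ord0 - a))%MM.
  rewrite mcoeffMX -trunc_approx // !mnm1_mdeg mnmX1E.
  exact: leq_subr.
by apply/mnmP => i; rewrite (ord1 i) mnmDE !mnmX1E subnKC.
Qed.

(* If Phi = sum_b a_b(x) y^b and a_b is the first nonconstant coefficient, then
   for z = c x^r + ... the series Phi(x, z(x)) has a term of degree [a + r b]
   with [0 < a < q], while [q] divides [r]. *)
Lemma const_in_x (Phi : mser 2 k) :
  (forall N, exists q z, [/\ (N < q)%N, z 0%MM = 0, exists m, z m != 0,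
     exp_dvd q z & exp_dvd q (ser_subst2 Phi varx z)]) ->
  forall m : 'X_{1..2}, m ord0 != 0%N -> Phi m = 0.
Proof.
move=> H m; have [b] := ubnP (m ord_max); elim: b m => // b IH m mb m0.
have {}IH (m' : 'X_{1..2}) : (m' ord_max < m ord_max)%N -> m' ord0 != 0%N -> Phi m' = 0.
  by move=> lt; apply: IH; lia.
set a := m ord0 in m0 *; set b0 := m ord_max in IH.
(* Taking [q > a] ensures that no integer from 1 to [a] is divisible by [q]. *)
have [q [z [aq z0 [m1 zm1] zq Pq]]] := H a.
have exr : exists r, z (U_(ord0) *+ r)%MM != 0.
  by exists (m1 ord0); rewrite -mnm1E1.
case: (ex_minnP exr) => r zr minr.
have zr_ord : order_ge r z.
  move=> d; rewrite mnm1_mdeg ltnNge => rd; apply/eqP; apply: contraNT rd => zd.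
  by apply: minr; rewrite -mnm1E1.
have qr : (q %| r)%N.
  apply: contraNT zr => qr; apply/eqP/(zq _ ord0).
  by rewrite mnmX1E.
have r0 : (0 < r)%N.
  by rewrite lt0n; apply: contraNneq zr => ->; rewrite mulm0n z0.
have qler : (q <= r)%N by apply: dvdn_leq.
have nq j : (0 < j <= a)%N -> ~~ (q %| j + r * b0)%N.
  move=> ja; rewrite dvdn_addl ?dvdn_mulr //; apply/negP => /dvdn_leq; lia.
pose M : 'X_{1..1} := (U_(ord0) *+ (a + r * b0))%MM.
have M0 : M ord0 = (a + r * b0)%N by rewrite mnmX1E.
(* Since [r >= 1], the index [m] lies in the range of the truncated sum giving the coefficient at
   [M]. *)
have dm : (mdeg m < (mdeg M).+1)%N.
  rewrite ltnS mnm1_mdeg M0 mdegE big_ord_recl big_ord1.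
  rewrite (_ : lift ord0 ord0 = ord_max) -/a -/b0; last exact: val_inj.
  by rewrite leq_add2l; apply: leq_pmull.
have := Pq M ord0; rewrite M0 nq ?lt0n ?m0 ?leqnn // => /(_ isT).
rewrite /ser_subst2 /ser_subst (bigD1 (BMultinom dm)) //=.
rewrite ser_mon2 ser_mul_varxX M0 -/a leq_addr addKn -/b0.
rewrite big1 ?addr0 => [|d dm'].
  move/eqP; rewrite mulf_eq0 => /orP[/eqP //|].
  (* [z'] is the leading term of [z]. It shows that the coefficient of [z^b0] in degree [r * b0] is
     a power of a nonzero scalar, so [Phi m] must vanish. *)
  pose z' : mser 1 k := fun d => (z (U_(ord0) *+ r)%MM *: 'X_[U_(ord0) *+ r])@_d.
  have z'_ord : order_ge r z'.
    move=> d dr; rewrite /z' mcoeffZ mcoeffX; case: eqP => [dE|]; last by rewrite mulr0.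
    by move: dr; rewrite -dE mnm1_mdeg mnmX1E ltnn.
  rewrite (lead_exp (e := b0) zr_ord z'_ord); first last.
  - by rewrite mnm1_mdeg mnmX1E mulnC.
  - move=> d; rewrite mnm1_mdeg => dr.
    by rewrite [d]mnm1E1 dr /z' mcoeffZ mcoeffX eqxx mulr1.
  rewrite (approx_exp (D := r * b0) b0 (P := z (U_(ord0) *+ r)%MM *: 'X_[U_(ord0) *+ r])) //.
    rewrite exprZn mcoeffZ mcoeffXn [(_ *+ _ *+ _)%MM]mnm1E1 mulmnE mnmX1E eqxx mulr1.
    by rewrite expf_eq0 (negbTE zr) andbF.
  by rewrite mnm1_mdeg mnmX1E.
rewrite ser_mon2 ser_mul_varxX M0; case: ifP => [ad|_]; last by rewrite mulr0.
set a' := d ord0 in ad *; set b' := d ord_max.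
have zexp0 j : ~~ (q %| j)%N -> ser_exp z b' (U_(ord0) *+ j)%MM = 0.
  by move=> qj; apply: (exp_dvd_exp b' zq (i := ord0)); rewrite mnmX1E.
have zexp_ord j : (j < r * b')%N -> ser_exp z b' (U_(ord0) *+ j)%MM = 0.
  move=> lj; apply: (order_ge_exp zr_ord).
  by rewrite mnm1_mdeg mnmX1E mulnC.
(* The other terms contribute nothing to the coefficient at [M]. If [b' < b0], induction leaves
   [a' = 0], and then [q] does not divide the exponent needed from [z^b']. If [b' > b0], that
   exponent is below [r * b'] because [a < q <= r]. If [b' = b0], it is not divisible by [q] for
   [a' < a] and is below the order for [a' > a]. *)
have [lb|gb|eb] := ltngtP b' b0.
- have [a0|a0] := eqVneq a' 0%N; last by rewrite IH ?mul0r.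
  by rewrite a0 subn0 zexp0 ?mulr0 // nq // lt0n m0 leqnn.
- by rewrite zexp_ord ?mulr0 //; nia.
- have [la|ga|ea] := ltngtP a' a.
  + rewrite zexp0 ?mulr0 // (_ : _ - _ = (a - a') + r * b0)%N; last lia.
    by apply: nq; lia.
  + by rewrite zexp_ord ?mulr0 // eb; lia.
  + case/eqP: dm'; apply: val_inj => /=; apply/mnmP => -[[|[|//]] lti].
    * by rewrite (_ : Ordinal lti = ord0) //; apply: val_inj.
    * by rewrite (_ : Ordinal lti = ord_max) //; apply: val_inj.
Qed.

End Rigidity.

(** * Endomorphisms of the formal group law *)

Section Endomorphisms.
Variables (k : fieldType) (p : nat) (G : mser 2 k).
Hypotheses (hp : p \in [pchar k]) (hG : formal_group_law G).

Local Notation add := (ser_subst2 G).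
Local Notation X0 := (varx_const k).

(** The defining identity concerns the two variables; [a] and [b] are substituted for them. *)
Lemma fgl_End_add f : fgl_End G f ->
  forall r (a b : mser r k), a 0%MM = 0 -> b 0%MM = 0 ->
  ser_comp f (add a b) = add (ser_comp f a) (ser_comp f b).
Proof.
move=> [f0 /functional_extensionality e] r a b a0 b0.
have := congr1 (fun h => ser_subst2 h a b) e.
rewrite /= ser_comp_subst2 ?add_const ?serX_const // ser_subst2_id => ->.
rewrite ser_subst2_subst2 ?ser_comp_const ?serX_const //.
rewrite !ser_comp_subst2 ?serX_const //.
by rewrite ser_subst2_serX0 // ser_subst2_serX1.
Qed.

Lemma fgl_End_sum f g : fgl_End G f -> fgl_End G g -> fgl_End G (add f g).
Proof.
move=> Ef Eg; have [f0 _] := Ef; have [g0 _] := Eg; split; first exact: add_const.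
move=> m; set x := serX _ (inord 0); set y := serX _ (inord 1).
have x0 : x 0%MM = 0 by apply: serX_const.
have y0 : y 0%MM = 0 by apply: serX_const.
have c0 := @ser_comp_const k 2; have xy0 := add_const hG x0 y0.
rewrite !(ser_subst2_comp G f0 g0) // (fgl_End_add Ef x0 y0) (fgl_End_add Eg x0 y0).
by rewrite (fgl_addACA hG) ?c0.
Qed.

Lemma fgl_End_comp f g : fgl_End G f -> fgl_End G g -> fgl_End G (ser_comp f g).
Proof.
move=> Ef Eg; have [f0 _] := Ef; have [g0 _] := Eg; split.
  by rewrite /no_const ser_comp_const.
move=> m; rewrite !ser_compA ?add_const ?serX_const //.
rewrite (fgl_End_add Eg) ?serX_const // (fgl_End_add Ef) //.
  by rewrite ser_comp_const ?serX_const.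
by rewrite ser_comp_const ?serX_const.
Qed.

Lemma fgl_End_varx : fgl_End G varx.
Proof.
by split; [exact: X0 | move=> m; rewrite !ser_comp_varx ?add_const ?serX_const].
Qed.

Lemma fgl_End_ser0 : fgl_End G (@ser0 k 1).
Proof. by split=> // m; rewrite !ser_comp0 addf0. Qed.

Lemma fgl_End_iter f n : fgl_End G f -> fgl_End G (ser_iter f n).
Proof.
move=> Ef; elim: n => [|n IH]; first exact: fgl_End_varx.
exact: fgl_End_comp.
Qed.

Local Notation inv := (fgl_inv G p).

Lemma inv_const : inv 0%MM = 0.
Proof. exact: fgl_mul_const. Qed.

Lemma add_inv r (f : mser r k) : f 0%MM = 0 ->
  add f (ser_comp inv f) = @ser0 k r.
Proof.
move=> f0; have := congr1 (fun h => ser_comp h f) (add_varx_inv hG hp).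
by rewrite /= ser_comp0 ser_subst2_comp ?X0 ?inv_const // ser_comp_varx.
Qed.

Lemma add_cancel r (f g h : mser r k) :
  f 0%MM = 0 -> g 0%MM = 0 -> h 0%MM = 0 -> add f g = add f h -> g = h.
Proof.
move=> f0 g0 h0 /(congr1 (add (ser_comp inv f))).
have i0 : ser_comp inv f 0%MM = 0 by rewrite ser_comp_const ?inv_const.
by rewrite -!fgl_addA // (fgl_addC hG i0 f0) add_inv // !add0f.
Qed.

Lemma fgl_End_inv : fgl_End G inv.
Proof.
split=> [|m]; first exact: inv_const.
set x := serX _ (inord 0); set y := serX _ (inord 1).
have x0 : x 0%MM = 0 by apply: serX_const.
have y0 : y 0%MM = 0 by apply: serX_const.
have ix0 : ser_comp inv x 0%MM = 0 by rewrite ser_comp_const ?inv_const.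
have iy0 : ser_comp inv y 0%MM = 0 by rewrite ser_comp_const ?inv_const.
have xy0 := add_const hG x0 y0.
(* Both candidates for the negative of x + y give 0 when added to it. *)
congr (_ m); apply: (@add_cancel _ (add x y)); rewrite ?add_const //.
  by rewrite ser_comp_const ?inv_const.
by rewrite add_inv // fgl_addACA // !add_inv // addf0.
Qed.

(* Comparing the coefficients of x^(N-1) y in f(G(x,y)) = G(f(x),f(y)) gives
   N f_N = 0 when f has no linear term. *)
Lemma fgl_End_exp_dvd f : fgl_End G f -> f U_(ord0)%MM = 0 -> exp_dvd p f.
Proof.
move=> [f0 Ef] f1.
have pp := pcharf_prime hp; have p1 := prime_gt1 pp.
suff H N : ~~ (p %| N)%N -> f (U_(ord0) *+ N)%MM = 0.
  by move=> m i; rewrite (ord1 i) => /H; rewrite -mnm1E1.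
have [b] := ubnP N; elim: b N => // b IH N Nb pN.
have N0 : (0 < N)%N by rewrite lt0n; apply: contraNneq pN => ->.
pose M : 'X_{1..2} := (U_(ord0) *+ N.-1 + U_(ord_max))%MM.
have M1 : M ord_max = 1%N by rewrite mnmDE mulmnE !mnm1E eqxx.
have degM : mdeg M = N by rewrite mdegD mdegMn !mdeg1; lia.
(* Series without terms of y-degree 1 form a subring. It contains f(x), and also f(y) as [f] has no
   linear term, so G(f(x), f(y)) has no coefficient at [M]. *)
pose noy (g : mser 2 k) := forall m : 'X_{1..2}, m ord_max = 1%N -> g m = 0.
have noyM g h : noy g -> noy h -> noy (ser_mul g h).
  move=> Hg Hh m m1; apply: ser_mul_eq0 => a c mE.
  move: m1; rewrite mE mnmDE; case ea: (a ord_max) => [|[|j]] // e.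
    by rewrite Hh ?mulr0.
  by rewrite Hg ?mul0r.
have noyX g e : noy g -> noy (ser_exp g e).
  move=> Hg; elim: e => [m m1|e IHe]; last exact: noyM.
  by rewrite /= /ser1; case: eqP => // m0; rewrite m0 mnm0E in m1.
have RHS0 : ser_subst2 G (ser_comp f (serX k (inord 0)))
                         (ser_comp f (serX k (inord 1))) M = 0.
  apply: big1 => d _; rewrite ser_mon2 noyM ?mulr0 //; apply: noyX => m m1.
    apply: big1 => c _; rewrite ser_mon1 ser_exp_serX; move: (bmnm c) => {}c.
    case: eqP => [mE|_]; last by rewrite mulr0.
    move: m1; rewrite -mE mulmnE mnm1E (_ : inord 0 == ord_max = false) //.
    by apply/eqP => /(congr1 val) /=; rewrite inordK.
  apply: big1 => c _; rewrite ser_mon1 ser_exp_serX; move: (bmnm c) => {}c.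
  case: eqP => [mE|_]; last by rewrite mulr0.
  move: m1; rewrite -mE mulmnE mnm1E (_ : inord 1 == ord_max :> 'I_2).
    by rewrite mul1n => c1; rewrite [c]mnm1E1 c1 f1 mul0r.
  by apply/eqP/val_inj; rewrite /= inordK.
have := Ef M; rewrite {}RHS0 ser_subst2_id.
have dN : (mdeg (U_(ord0) *+ N : 'X_{1..1})%MM < (mdeg M).+1)%N.
  by rewrite mnm1_mdeg mnmX1E degM.
rewrite /ser_comp /ser_subst (bigD1 (BMultinom dN)) //= big1 ?addr0 => [|d dN'].
  rewrite ser_mon1 mnmX1E => /eqP; rewrite mulf_eq0 => /orP[/eqP //|].
  (* The lowest form of [G] is x + y, so the coefficient of [G^N] at [M] is the binomial ['C(N, 1)]
     = N, nonzero in [k]. *)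
  pose L : mser 2 k := fun d => ('X_ord0 + 'X_ord_max : {mpoly k[2]})@_d.
  have LG : order_ge 1 L.
    by apply/order_ge_const; rewrite /L mcoeffD !mcoeffX !mnm1_eq0 addr0.
  rewrite (lead_exp (e := N) (order_ge_const (fgl_const hG)) LG); first last.
  - by rewrite muln1.
  - move=> m /eqP /mdeg1P[i /eqP ->]; rewrite /L mcoeffD !mcoeffXU.
    case: i => -[|[|//]] lti.
      rewrite (_ : Ordinal lti = ord0); last exact: val_inj.
      by rewrite fgl_coef10 // addr0.
    rewrite (_ : Ordinal lti = ord_max); last exact: val_inj.
    by rewrite fgl_coef01 // add0r.
  rewrite (approx_exp (D := N) N (P := 'X_ord0 + 'X_ord_max)) ?degM //.
  rewrite exprDn (raddf_sum (mcoeff M)) /=.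
  have N1 : (1 < N.+1)%N by [].
  rewrite (bigD1 (Ordinal N1)) //= mcoeffMn !mpolyXn -mpolyXD mcoeffX subn1 mulm1n eqxx.
  rewrite big1 ?addr0 => [|i iN]; last first.
    rewrite mcoeffMn !mpolyXn -mpolyXD mcoeffX; case: eqP => [e|]; last by rewrite mul0rn.
    have := congr1 (fun m : 'X_{1..2} => m ord_max) e.
    rewrite M1 /= mnmDE !mulmnE !mnm1E eqxx /= mul1n add0n => i1.
    by case/eqP: iN; apply: val_inj.
  by rewrite bin1 -(dvdn_pcharf hp) (negbTE pN).
rewrite ser_mon1; have ld : (d ord0 < N)%N.
  have := leq_trans (bmdeg d : (mdeg d <= mdeg M)%N) (eq_leq degM).
  rewrite mnm1_mdeg leq_eqVlt => /orP[/eqP e|//].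
  by case/eqP: dN'; apply: val_inj; rewrite /= [LHS]mnm1E1 e.
(* For exponents d < N: if p does not divide d, induction kills the coefficient of [f]; otherwise
   [G^d] is a p-th power, and [M] has y-exponent 1. *)
have [/dvdnP[j ->]|pd] := boolP (p %| d ord0)%N; last first.
  by rewrite [bmnm d]mnm1E1 IH ?mul0r //; lia.
rewrite ser_expM (exp_dvd_frobenius hp (exp_dvd_trivial _) (i := ord_max)) ?mulr0 //.
by rewrite M1 mul1n dvdn1 neq_ltn p1 orbT.
Qed.

(** * Iterates, and endomorphisms with linear coefficient 1 *)

Lemma ser_iter_const f n : f 0%MM = 0 -> ser_iter f n 0%MM = 0 :> k.
Proof.
move=> f0; elim: n => [|n IH]; first exact: X0.
by rewrite /= ser_comp_const.
Qed.

Lemma ser_iterD (f : mser 1 k) m n : f 0%MM = 0 ->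
  ser_iter f (m + n) = ser_comp (ser_iter f m) (ser_iter f n).
Proof.
move=> f0; elim: m => [|m IH].
  by rewrite add0n ser_comp_varx // ser_iter_const.
by rewrite addSn /= -!/(ser_iter f _) IH ser_compA ?ser_iter_const.
Qed.

Lemma ser_iterM (f : mser 1 k) m n : f 0%MM = 0 ->
  ser_iter (ser_iter f m) n = ser_iter f (n * m).
Proof.
move=> f0; elim: n => [//|n IH].
by rewrite mulSn ser_iterD // -IH.
Qed.

Lemma ser_iter_lin (f : mser 1 k) n : f 0%MM = 0 ->
  ser_iter f n U_(ord0)%MM = f U_(ord0)%MM ^+ n.
Proof.
move=> f0; elim: n => [|n IH]; first by rewrite /= /varx /serX eqxx.
by rewrite /= -/(ser_iter f n) ser_comp_lin ?mdeg1 ?ser_iter_const // IH exprS.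
Qed.

Lemma ser_iter_comm (f g : mser 1 k) n : f 0%MM = 0 -> g 0%MM = 0 ->
  ser_comp f g = ser_comp g f ->
  ser_comp (ser_iter f n) g = ser_comp g (ser_iter f n).
Proof.
move=> f0 g0 fg; elim: n => [|n IH]; first by rewrite ser_comp_varx ?ser_comp_id.
rewrite /= -/(ser_iter f n) ser_compA ?ser_iter_const // IH.
by rewrite -ser_compA ?ser_iter_const // fg ser_compA ?ser_iter_const.
Qed.

(* In End(G): (1 + z)^n = 1 + z (1 + v + ... + v^(n-1)) with v = 1 + z. *)
Lemma iter_unipotent v z n : fgl_End G v -> fgl_End G z -> v = add varx z ->
  exists s, [/\ fgl_End G s, ser_iter v n = add varx (ser_comp z s) &
    v U_(ord0)%MM = 1 -> s U_(ord0)%MM = n%:R].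
Proof.
move=> Ev Ez vE; have [v0 _] := Ev; have [z0 _] := Ez.
elim: n => [|n [s [Es sE s1]]].
  exists (@ser0 k 1); split=> //; first exact: fgl_End_ser0.
  by rewrite ser_comp_ser0 // addf0 // X0.
have En := fgl_End_iter n Ev; have [n0 _] := En; have [s0 _] := Es.
exists (add s (ser_iter v n)); split; first exact: fgl_End_sum.
  rewrite (fgl_End_add Ez) // -fgl_addA ?X0 ?ser_comp_const // -sE.
  have -> : ser_iter v n.+1 = ser_comp (add varx z) (ser_iter v n) by rewrite -vE.
  by rewrite ser_subst2_comp ?X0 // ser_comp_varx.
by move=> v1; rewrite add_lin ?mdeg1 // s1 // ser_iter_lin // v1 expr1n natr1.
Qed.

(** Replacing N by pN composes [z] with an endomorphism [s] of linear coefficient p = 0. Then [s] is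
    a series in x^p, and the exponents of [z o s] gain a factor p. *)
Lemma unipotent_iter_exp_dvd v c : fgl_End G v -> v U_(ord0)%MM = 1 ->
  exists N z, [/\ (0 < N)%N, fgl_End G z, exp_dvd (p ^ c.+1) z &
    ser_iter v N = add varx z].
Proof.
move=> Ev v1; have [v0 _] := Ev.
elim: c => [|c [N [z [N0 Ez zq NE]]]].
  have Ei := fgl_End_inv; have i0 := inv_const.
  have E1 : fgl_End G (add v inv) by apply: fgl_End_sum.
  (* This is v - x; its linear coefficient is 1 + (p - 1) = 0. *)
  exists 1%N, (add v inv); split=> //.
    apply: fgl_End_exp_dvd => //; rewrite add_lin ?mdeg1 // v1.
    rewrite /fgl_inv mdeg1 expn1 fgl_mul_lin // natrB ?prime_gt0 ?(pcharf_prime hp) //.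
    by rewrite (pcharf0 hp) sub0r subrr.
  rewrite /= ser_comp_id (fgl_addC hG v0 i0) -fgl_addA ?X0 //.
  by rewrite add_varx_inv // add0f.
have EN := fgl_End_iter N Ev; have [N00 _] := EN.
have [s [Es sE s1]] := iter_unipotent p EN Ez NE.
exists (p * N)%N, (ser_comp z s); split.
- by rewrite muln_gt0 prime_gt0 ?(pcharf_prime hp).
- exact: fgl_End_comp.
- rewrite expnS; apply: exp_dvd_comp => //; apply: fgl_End_exp_dvd => //.
  by rewrite s1 ?(pcharf0 hp) // ser_iter_lin // v1 expr1n.
- by rewrite -ser_iterM.
Qed.

(** * The linear coefficient of an endomorphism at finite height *)

Lemma fgl_mul_comm u n : fgl_End G u ->
  ser_comp u (fgl_mul G n) = ser_comp (fgl_mul G n) u.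
Proof.
move=> Eu; have [u0 _] := Eu; elim: n => [|n IH].
  by rewrite ser_comp_ser0 // ser_comp0.
rewrite fgl_mulS (fgl_End_add Eu) ?X0 ?fgl_mul_const // IH.
by rewrite ser_subst2_comp ?X0 ?fgl_mul_const // ser_comp_id ser_comp_varx.
Qed.

(* The coefficient of degree p^h in u([p](x)) = [p](u(x)). *)
Lemma finite_height_lin u h : has_height p G h -> fgl_End G u ->
  u U_(ord0)%MM ^+ (p ^ h) = u U_(ord0)%MM.
Proof.
move=> [hlt [m mh mn0]] Eu; have [u0 _] := Eu.
set q := (p ^ h)%N in hlt mh *; set P := fgl_mul G p in hlt mn0.
have P0 : P 0%MM = 0 by apply: fgl_mul_const.
have mE : m = (U_(ord0) *+ q)%MM by rewrite [m]mnm1E1 -mnm1_mdeg mh.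
have q0 : (0 < q)%N by rewrite expn_gt0 prime_gt0 ?(pcharf_prime hp).
have := congr1 (fun f => f m) (fgl_mul_comm p Eu); rewrite -/P.
have U1 : (mdeg U_(ord0 : 'I_1)%MM < (mdeg m).+1)%N by rewrite mdeg1 mh.
have Um : (mdeg m < (mdeg m).+1)%N by [].
(* In degree [q] only the linear term of [u] survives in [u o P], and only the degree-[q] term of
   [P] survives in [P o u], since [P] has order [q]. *)
rewrite /ser_comp /ser_subst (bigD1 (BMultinom U1)) //= big1 ?addr0 => [|d d1].
  rewrite (bigD1 (BMultinom Um)) //= big1 ?addr0 => [|d dm].
    rewrite !ser_mon1 mnm1E eqxx /= /ser_exp /= ser_mulr1 -!/(ser_exp u _).
    pose L : mser 1 k := fun d => (u U_(ord0)%MM *: 'X_ord0 : {mpoly k[1]})@_d.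
    have LG : order_ge 1 L.
      by apply/order_ge_const; rewrite /L mcoeffZ mcoeffX mnm1_eq0 mulr0.
    rewrite (lead_exp (e := m ord0) (order_ge_const u0) LG); first last.
    - by rewrite mnm1_mdeg muln1.
    - move=> e /eqP /mdeg1P[i /eqP ->]; rewrite (ord1 i) /L mcoeffZ mcoeffXU.
      by rewrite eqxx mulr1.
    rewrite (approx_exp (D := mdeg m) (m ord0) (P := u U_(ord0)%MM *: 'X_ord0)) //.
    rewrite exprZn mcoeffZ mcoeffXn -mnm1E1 eqxx mulr1 mulrC => /(mulfI mn0) e.
    by rewrite [RHS]e -mnm1_mdeg mh.
  rewrite hlt ?mul0r // -mh; have := bmdeg d; rewrite ltnS leq_eqVlt.
  case/orP=> [/eqP e|//]; case/eqP: dm; apply: val_inj => /=.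
  by rewrite [LHS]mnm1E1 [RHS]mnm1E1 -!mnm1_mdeg e.
rewrite ser_mon1; case ed: (d ord0) => [|[|j]].
- by rewrite [bmnm d]mnm1E1 ed mulm0n u0 mul0r.
- by case/eqP: d1; apply: val_inj; rewrite /= [LHS]mnm1E1 ed mulm1n.
- by rewrite (order_ge_exp (e := j.+2) hlt) ?mulr0 // mh; nia.
Qed.

End Endomorphisms.

(** * Series commuting with a nontorsion automorphism *)

Theorem theorem3p1 (k : fieldType) (p : nat) (hp : p \in [pchar k])
    (G : mser 2 k) (hG : formal_group_law G) (hh : finite_height p G)
    (K : fieldType) (iota : {rmorphism k -> K})
    (hK : algebraic_closure iota) (hlarge : all_End_over_base iota G)
    (u : mser 1 k) (hu : fgl_Aut G u) (hnt : nontorsion u)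
    (psi : mser 1 k) (hpsi : no_const psi)
    (hcomm : ser_comp u psi =1 ser_comp psi u) :
  fgl_End G psi.
Proof.
move: hcomm => /functional_extensionality hcomm.
have [Eu [w [w0 _] [/functional_extensionality uw _]]] := hu.
have [u0 _] := Eu; have [h hh'] := hh; have pp := pcharf_prime hp.
have u1 : u U_(ord0)%MM != 0.
  have := congr1 (fun f => f U_(ord0)%MM) uw.
  rewrite /= ser_comp_lin ?mdeg1 // /varx /serX eqxx => e.
  by apply/eqP => u1; move/eqP: e; rewrite u1 mul0r eq_sym oner_eq0.
have h0 : (0 < h)%N.
  rewrite lt0n; apply: contraTneq isT => e; have [_ [m mh]] := hh'.
  move: mh; rewrite e expn0 => /eqP /mdeg1P[i /eqP ->].
  by rewrite (ord1 i) fgl_mul_lin // (pcharf0 hp) eqxx.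
have q1 : (1 < p ^ h)%N by rewrite -(exp1n h) ltn_exp2r // prime_gt1.
pose n0 := (p ^ h).-1.
have v1 : ser_iter u n0 U_(ord0)%MM = 1.
  rewrite ser_iter_lin //; apply: (mulfI u1); rewrite mulr1 -exprS.
  by rewrite prednK ?(finite_height_lin hp hG hh') //; lia.
set x := serX k (inord 0 : 'I_2); set y := serX k (inord 1 : 'I_2).
have x0 : x 0%MM = 0 by apply: serX_const.
have y0 : y 0%MM = 0 by apply: serX_const.
have X0 := varx_const k.
have px0 : ser_comp psi x 0%MM = 0 by rewrite ser_comp_const.
have py0 : ser_comp psi y 0%MM = 0 by rewrite ser_comp_const.
have i0 := inv_const p hG.
pose Phi := ser_subst2 G (ser_comp (fgl_inv G p) (ser_comp psi x)) (ser_comp psi G).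
have G0 := fgl_const hG.
have pG0 : ser_comp psi G 0%MM = 0 by rewrite ser_comp_const.
have ipx0 : ser_comp (fgl_inv G p) (ser_comp psi x) 0%MM = 0.
  by rewrite ser_comp_const.
have Phi0 : Phi 0%MM = 0 by apply: add_const.
have PhiE : ser_subst2 G (ser_comp psi x) Phi = ser_comp psi G.
  by rewrite -fgl_addA // add_inv // add0f.
have PhiE2 r (a b : mser r k) : a 0%MM = 0 -> b 0%MM = 0 ->
    ser_subst2 G (ser_comp psi a) (ser_subst2 Phi a b) =
    ser_comp psi (ser_subst2 G a b).
  move=> a0 b0; have := congr1 (fun f => ser_subst2 f a b) PhiE.
  rewrite /= ser_subst2_subst2 // !ser_comp_subst2 //.
  by rewrite ser_subst2_serX0.
have PhiC : forall m : 'X_{1..2}, m ord0 != 0%N -> Phi m = 0.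
  apply: const_in_x => c.
  have [N [z [N0 Ez zq NE]]] :=
    unipotent_iter_exp_dvd hp hG c (fgl_End_iter hG n0 Eu) v1.
  have [z0 _] := Ez; rewrite ser_iterM // in NE.
  exists (p ^ c.+1)%N, z; split=> //.
  - exact: leq_ltn_trans (leqnSn c) (ltn_expl _ (prime_gt1 pp)).
  - have /not_all_ex_not[m /eqP zm] : ~ forall m, z m = 0.
      move=> /functional_extensionality z_eq0.
      apply: (hnt (N * n0)%N); first by rewrite muln_gt0 N0; lia.
      by rewrite NE z_eq0 addf0.
    by exists m.
  rewrite (_ : ser_subst2 Phi varx z = ser_comp z psi).
    rewrite -[(p ^ c.+1)%N]mul1n; apply: exp_dvd_comp => //.
    exact: exp_dvd_trivial.
  apply: (add_cancel hp hG hpsi); rewrite ?ser_subst2_const ?ser_comp_const //.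
  rewrite -{1}(ser_comp_id psi) PhiE2 // -NE -ser_iter_comm // NE.
  by rewrite ser_subst2_comp // ser_comp_varx.
have PhiY : Phi = ser_comp psi y.
  have e : Phi = ser_subst2 Phi (@ser0 k 2) y.
    rewrite -[LHS]ser_subst2_id; apply: functional_extensionality => m.
    apply: eq_bigr => d _; rewrite !ser_mon2.
    by have [->|d0] := eqVneq (d ord0) 0%N; [|rewrite PhiC ?mul0r].
  have e0 : ser_subst2 Phi (@ser0 k 2) y 0%MM = 0 by rewrite ser_subst2_const.
  have := PhiE2 _ (@ser0 k 2) y (erefl _) y0.
  by rewrite ser_comp_ser0 // (add0f hG e0) (add0f hG y0) -e.
by split=> // m; rewrite -/x -/y ser_subst2_id -PhiY PhiE.
Qed.
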